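(* Let $n\ge 2$ and let $\mathbb{Z}^n\curvearrowright X$ be a free Borel action of $\mathbb{Z}^n$ on a Polish space $X$. Then there is a Borel perfect matching for the Schreier graph of the action on $X$ (with respect to the standard generators of $\mathbb{Z}^n$).
   Context: The standard generating set of $\mathbb{Z}^n$ is $\{\pm e_1,\dots,\pm e_n\}$, where $e_i$ has $i$-th coordinate $1$ and other coordinates $0$. The Schreier graph of an action $\mathbb{Z}^n\curvearrowright X$ has vertex set $X$ and edges $(x,y)$ with $y=s\cdot x$ for some standard generator $s$. A perfect matching of a graph $G$ is a map $m:V(G)\to V(G)$ such that for all $x\in V(G)$, $(x,m(x))\in E(G)$ and $m(m(x))=x$. It is Borel if $m$ is a Borel map. *)

(* Defs.v *)
From HB Require Import structures.
From mathcomp Require Import all_boot all_order all_algebra.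
From mathcomp Require Import all_classical reals topology measurable_structure.

Set Implicit Arguments.
Unset Strict Implicit.
Unset Printing Implicit Defensive.

Import Order.TTheory GRing.Theory Num.Theory.

Local Open Scope classical_set_scope.
Local Open Scope ring_scope.

Section PolishSpaces.
Context (R : realType) (X : topologicalType).

Definition is_metric (d : X -> X -> R) : Prop :=
  [/\ forall x y, 0 <= d x y,
      forall x y, d x y = 0 <-> x = y,
      forall x y, d x y = d y x &
      forall x y z, d x z <= d x y + d y z].

Definition metric_compatible (d : X -> X -> R) : Prop :=
  forall (x : X) (A : set X),
    nbhs x A <-> exists2 e : R, 0 < e & [set y | d x y < e] `<=` A.

Definition metric_complete (d : X -> X -> R) : Prop :=
  forall u : nat -> X,
    (forall e : R, 0 < e ->
       exists N, forall i j, (N <= i)%N -> (N <= j)%N -> d (u i) (u j) < e) ->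
    exists l : X, u @ \oo --> l.

Definition completely_metrizable : Prop :=
  exists d : X -> X -> R,
    [/\ is_metric d, metric_compatible d & metric_complete d].

Definition separable : Prop := exists2 D : set X, countable D & dense D.

Definition polish_space : Prop := separable /\ completely_metrizable.

End PolishSpaces.

(* The library's measurable types are pointed; working with the sigma-algebra
   generated by the open sets directly does not exclude the empty space. *)
Definition borel_set (X : topologicalType) : set (set X) := <<s @open X >>.

Definition borel_map (X Y : topologicalType) (f : X -> Y) : Prop :=
  forall B : set Y, borel_set B -> borel_set (f @^-1` B).

Section Actions.
Context (n : nat).

Definition is_action (X : Type) (act : 'rV[int]_n -> X -> X) : Prop :=
  (forall x, act 0 x = x) /\
  (forall u v x, act (u + v) x = act u (act v x)).

Definition free_action (X : Type) (act : 'rV[int]_n -> X -> X) : Prop :=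
  forall u x, act u x = x -> u = 0.

(* Joint Borel measurability of Z^n * X -> X, with Z^n discrete. *)
Definition borel_action (X : topologicalType) (act : 'rV[int]_n -> X -> X)
    : Prop :=
  is_action act /\
  borel_map (fun p : (discrete_topology 'rV[int]_n * X)%type => act p.1 p.2).

Definition std_generators : set 'rV[int]_n :=
  [set s | exists i : 'I_n, s = delta_mx 0 i \/ s = - delta_mx 0 i].

Definition schreier_graph (X : Type) (act : 'rV[int]_n -> X -> X)
    (x y : X) : Prop :=
  exists2 s, std_generators s & y = act s x.

End Actions.

Definition perfect_matching (V : Type) (E : V -> V -> Prop) (m : V -> V)
    : Prop :=
  forall x, E x (m x) /\ m (m x) = x.

(* Main.v *)
(* It suffices to treat a free action of Z^2. At scale q_n, boundedly many (50)
   Borel families of squares of radius 10 q_n, each with gaps comparable to q_n,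
   cover X. By pigeonhole some family covers a given point infinitely often, and a
   whole orbit can use the same family; enlarging the squares slightly gives one
   well separated family of squares per scale, which together cover X. Absorbing
   nearby smaller squares and completing to 2 x 2 blocks aligned with the centre
   turns these squares into finite tiles whose boundaries stay away from each
   other. A point is matched horizontally inside its block in the lowest-level
   tile containing it, unless it lies beside a lower-level tile whose horizontal
   phase differs: the two columns bordering that tile are matched vertically,
   which shifts the phase of the rows that pass through the tile. *)
Require Import Defs.
From mathcomp Require Import all_boot all_order all_algebra.
From mathcomp Require Import all_classical reals topology measurable_structure.
From mathcomp Require Import zify.

Set Implicit Arguments.
Unset Strict Implicit.
Unset Printing Implicit Defensive.
Import Order.TTheory GRing.Theory Num.Theory.
Local Open Scope classical_set_scope.
Local Open Scope ring_scope.

(** * Borel sets: countable operations, separation of points, sections *)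

Section BorelSets.
Context (X : topologicalType).
Implicit Types S U : set X.

Lemma eq_borel S U : (forall x, U x <-> S x) -> borel_set S -> borel_set U.
Proof. by move=> SU; rewrite (_ : U = S) //; apply/seteqP; split=> x /SU. Qed.

Lemma borel_const (P : Prop) : borel_set [set _ : X | P].
Proof.
have [p|np] := pselect P; last first.
  rewrite (_ : [set _ | P] = set0); first exact: sigma_algebra0.
  by apply/seteqP; split=> x /=.
rewrite (_ : [set _ | P] = [set: X] `\` set0).
  by apply: sigma_algebraCD; exact: sigma_algebra0.
by apply/seteqP; split=> x //= _; split.
Qed.

Lemma borel_not S : borel_set S -> borel_set [set x | ~ S x].
Proof.
move=> bS; rewrite (_ : [set x | ~ S x] = setT `\` S); first exact: sigma_algebraCD.
by apply/seteqP; split=> x //= -[].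
Qed.

Lemma borel_ex (I : countType) (F : I -> set X) :
  (forall i, borel_set (F i)) -> borel_set [set x | exists i, F i x].
Proof.
move=> bF; rewrite (_ : mkset _ =
  \bigcup_k (if unpickle k is Some i then F i else set0)).
  apply: sigma_algebra_bigcup => k; case: unpickle => [i|]; first exact: bF.
  exact: sigma_algebra0.
apply/seteqP; split=> x /=.
  by move=> [i Fi]; exists (pickle i) => //; rewrite pickleK.
by move=> [k _]; case: unpickle => // i Fi; exists i.
Qed.

Lemma borel_all (I : countType) (F : I -> set X) :
  (forall i, borel_set (F i)) -> borel_set [set x | forall i, F i x].
Proof.
move=> bF; rewrite (_ : mkset _ = [set x | ~ exists i, ~ F i x]).
  by apply: borel_not; apply: borel_ex => i; apply: borel_not; exact: bF.
apply/seteqP; split=> x /= Fx; first by move=> [i]; apply.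
by move=> i; apply: contrapT => nF; apply: Fx; exists i.
Qed.

Lemma borel_and S U :
  borel_set S -> borel_set U -> borel_set [set x | S x /\ U x].
Proof.
move=> bS bU; rewrite (_ : mkset _ = [set x | forall b : bool, (if b then S else U) x]).
  by apply: borel_all => -[].
by apply/seteqP; split=> x /=; [move=> [? ?] []|move=> h; split; [exact: (h true)|exact: (h false)]].
Qed.

Lemma borel_or S U :
  borel_set S -> borel_set U -> borel_set [set x | S x \/ U x].
Proof.
move=> bS bU; rewrite (_ : mkset _ = [set x | exists b : bool, (if b then S else U) x]).
  by apply: borel_ex => -[].
apply/seteqP; split=> x /=; first by move=> [?|?]; [exists true|exists false].
by move=> [[] ?]; [left|right].
Qed.

(** Balls of radius [1/(k+1)] about the points of a countable dense set suffice, by the triangle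
    inequality. *)
Lemma separating_borel_sets (R : realType) : polish_space R X ->
  exists O : nat * nat -> set X, (forall i, borel_set (O i)) /\
    (forall x y, x <> y -> exists i, O i x /\ ~ O i y).
Proof.
move=> [[D /countable_injP[f finj] Ddense] [d [[dge0 d0 dsym dtri] dcomp _]]].
pose r (k : nat) : R := k.+1%:R^-1.
have rgt0 k : 0 < r k by rewrite invr_gt0 ltr0n.
have obal z e : open [set y | d z y < e].
  rewrite openE => y /= dzy; apply/dcomp; exists (e - d z y).
    by rewrite subr_gt0.
  move=> w /= dyw; apply: le_lt_trans (dtri z y w) _.
  by rewrite -ltrBrDl.
(* [f] is injective on [D], so this union has at most one ball; it is empty for codes that no dense
   point has. *)
pose O (i : nat * nat) := \bigcup_(z in [set z | D z /\ f z = i.1]) [set y | d z y < r i.2].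
exists O; split=> [i|x y xy].
  by apply: sub_sigma_algebra; apply: bigcup_open => z _; exact: obal.
have dxy : 0 < d x y.
  by rewrite lt_neqAle dge0 andbT eq_sym; apply/eqP => /d0.
have [k rk] : exists k, r k + r k < d x y.
  have e0 : 0 < d x y / 2 by rewrite divr_gt0.
  have [k hk] := ltr_add_invr e0; exists k.
  by rewrite [ltRHS]splitr; rewrite add0r in hk; apply: ltrD.
have [z [/= dxz Dz]] : [set z | d x z < r k] `&` D !=set0.
  apply: Ddense; last exact: obal.
  by exists x => /=; rewrite (d0 x x).2.
exists (f z, k); split.
  by exists z => //=; rewrite dsym.
move=> [w [/= Dw fwz]] dwy.
have wz : w = z by apply: finj => //; exact/mem_set.
move: dwy; rewrite wz => dzy.
have := le_lt_trans (dtri x z y) (ltrD dxz dzy).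
by move/(lt_trans rk); rewrite ltxx.
Qed.

(** The sets with Borel section at [u] form a sigma-algebra containing the open sets. Joint
    measurability of the action thus passes to each single group element. *)
Lemma borel_section (Y : topologicalType) (u : Y) (C : set (Y * X)) :
  borel_set C -> borel_set [set x | C (u, x)].
Proof.
move: C; apply: smallest_sub.
  split=> [|A bA|A bA] /=.
  - exact: borel_const.
  - rewrite (_ : mkset _ = [set x | ~ A (u, x)]); first exact: borel_not.
    by apply/seteqP; split=> x //= -[].
  - rewrite (_ : mkset _ = [set x | exists k, A k (u, x)]); first exact: borel_ex.
    by apply/seteqP; split=> x /= [k]; [exists k|exists k].
move=> A oA; apply: sub_sigma_algebra.
rewrite (_ : mkset _ = (fun x => (u, x)) @^-1` A) //.
apply: open_comp oA => x _.
by apply: cvg_pair; [exact: cvg_cst|exact: cvg_id].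
Qed.

End BorelSets.

(** * Maximal scattered Borel sets for a free action of the plane lattice *)

Section PlaneAction.
Context (X : topologicalType) (T : int -> int -> X -> X).
Hypothesis T0 : forall x, T 0 0 x = x.
Hypothesis TD : forall a b c d x, T a b (T c d x) = T (a + c) (b + d) x.
Hypothesis Tfree : forall a b x, T a b x = x -> a = 0 /\ b = 0.
Hypothesis Tborel : forall a b S, borel_set S -> borel_set (T a b @^-1` S).
Implicit Types (S U M : set X) (r : int).

Definition nb r S : set X :=
  [set x | exists a b, [/\ `|a| <= r, `|b| <= r & S (T a b x)]].

Definition scattered r S := forall x a b,
  S x -> S (T a b x) -> `|a| <= r -> `|b| <= r -> a = 0 /\ b = 0.

Lemma borel_translate a b S : borel_set S -> borel_set [set x | S (T a b x)].
Proof. exact: Tborel. Qed.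

Lemma borel_nb r S : borel_set S -> borel_set (nb r S).
Proof.
move=> bS; apply: borel_ex => a; apply: borel_ex => b.
apply: (@eq_borel _ [set x | (`|a| <= r /\ `|b| <= r) /\ S (T a b x)]).
  by move=> x; split=> [[]|[[]]].
by apply: borel_and; [exact: borel_const|exact: borel_translate].
Qed.

Lemma nb_sub r S : 0 <= r -> S `<=` nb r S.
Proof. by move=> r0 x Sx; exists 0, 0; split; rewrite ?T0 ?normr0. Qed.

(** By freeness a nonzero [g] moves [x] to a different point, which some [O i] separates from [x]. A
    word [s] records one such index per element of [gs], and there are only countably many words. *)
Lemma displacing_cover (O : nat * nat -> set X) :
    (forall i, borel_set (O i)) ->
    (forall x y, x <> y -> exists i, O i x /\ ~ O i y) ->
  forall gs : seq (int * int), exists W : seq (nat * nat) -> set X,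
  [/\ forall s, borel_set (W s), forall x, exists s, W s x &
      forall g s x, g \in gs -> g != 0 -> W s x -> ~ W s (T g.1 g.2 x)].
Proof.
move=> bO sepO; elim=> [|g gs [W [bW cW dW]]].
  exists (fun=> setT); split=> //.
  - by move=> _; exact: (@borel_const X True).
  - by move=> x; exists [::].
pose V (s : seq (nat * nat)) := if s is i :: s' then
  [set x | (g != 0 -> O i x /\ ~ O i (T g.1 g.2 x)) /\ W s' x] else set0.
exists V; split.
- case=> [|i s]; first exact: sigma_algebra0.
  apply: borel_and => //; case: (g != 0).
    apply: (@eq_borel _ [set x | O i x /\ ~ O i (T g.1 g.2 x)]).
      by move=> x; split=> //; exact.
    apply: borel_and; first exact: bO.
    by apply: borel_not; apply: borel_translate; exact: bO.
  by apply: (@eq_borel _ [set _ | True]); [|exact: borel_const].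
- move=> x; have [s Ws] := cW x.
  have [g0|g0] := eqVneq g 0.
    by exists ((0%N, 0%N) :: s); split=> //; rewrite g0 eqxx.
  have /sepO[i Oi] : x <> T g.1 g.2 x.
    by move=> /esym/Tfree[g1 g2]; case/eqP: g0; rewrite [LHS]surjective_pairing g1 g2.
  by exists (i :: s).
- move=> h [|i s] x; first by move=> _ _ [].
  rewrite inE => /orP[/eqP hg|hgs] h0 [Ox Wx] [Oy Wy].
    rewrite hg in h0 Oy; by have [_] := Ox h0; have [] := Oy h0.
  exact: (dW _ _ _ hgs h0 Wx).
Qed.

Lemma displacing_sequence (R : realType) r : polish_space R X ->
  exists W : nat -> set X, [/\ forall k, borel_set (W k),
    forall x, exists k, W k x & forall k, scattered r (W k)].
Proof.
move=> /separating_borel_sets[O [bO sepO]].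
pose rg := [seq i%:Z | i <- iota 0 `|r|.+1] ++ [seq - i%:Z | i <- iota 0 `|r|.+1].
have rgP a : `|a| <= r -> a \in rg.
  move=> ar; rewrite mem_cat; apply/orP.
  have [a0|a0] := lerP 0 a; [left|right]; apply/mapP; exists `|a|%N; rewrite ?mem_iota; lia.
have [W [bW cW dW]] := displacing_cover bO sepO [seq (a, b) | a <- rg, b <- rg].
exists (fun k => if unpickle k is Some s then W s else set0); split.
- by move=> k; case: unpickle => [s|]; [exact: bW|exact: sigma_algebra0].
- by move=> x; have [s Ws] := cW x; exists (pickle s); rewrite pickleK.
- move=> k x a b; case: unpickle => // s Wx Wy ar br.
  apply: contrapT => ab; apply: (dW (a, b) s x _ _ Wx Wy).
    by apply/allpairsP; exists (a, b); rewrite !rgP.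
  by apply/eqP => -[a0 b0]; apply: ab.
Qed.

(** A stage may add all eligible points of [W k'] at once: when the pieces are scattered, these do
    not conflict with one another. *)
Fixpoint greedy (r : int) S (W : nat -> set X) (k : nat) : set X :=
  if k is k'.+1 then
    [set x | greedy r S W k' x \/
      ((S x /\ W k' x) /\ ~ nb r (greedy r S W k') x)]
  else set0.

(** The greedy union is maximal: a point of [S] in [W k] is left out at stage [k.+1] only if a point
    within [r] was chosen before. *)
Lemma maximal_scattered (R : realType) r S :
    polish_space R X -> 0 <= r -> borel_set S ->
  exists M, [/\ borel_set M, scattered r M, M `<=` S & S `<=` nb r M].
Proof.
move=> /(displacing_sequence r)[W [bW cW dW]] r0 bS.
pose G := greedy r S W.
have Gmono k l : (k <= l)%N -> G k `<=` G l.
  move=> /subnK <-; elim: (l - k)%N => // i IH x /IH Gx.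
  by rewrite addSn; left.
have bG k : borel_set (G k).
  elim: k => [|k IH] /=; first exact: sigma_algebra0.
  apply: borel_or => //; apply: borel_and; first exact: borel_and.
  by apply: borel_not; exact: borel_nb.
exists [set x | exists k, G k x]; split.
- exact: borel_ex.
- move=> x a b [k Gk] [l Gl].
  have {Gk Gl} : G (k + l)%N x /\ G (k + l)%N (T a b x).
    by split; [apply: Gmono Gk; exact: leq_addr|apply: Gmono Gl; exact: leq_addl].
  elim: (k + l)%N => [[]//|{k l}k IH].
  move=> [[Gx|[[_ Wx] nx]] [Gy|[[_ Wy] ny]]] ar br.
  + exact: IH.
  + by case: ny; exists (- a), (- b); rewrite TD !addNr T0 !normrN.
  + by case: nx; exists a, b.
  + exact: dW Wx Wy ar br.
- by move=> x [k]; elim: k => //= k IH [/IH|[[]]].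
- move=> x Sx; have [k Wk] := cW x.
  have [[a [b [ar br Gy]]]|nG] := pselect (nb r (G k) x).
    by exists a, b; split=> //; exists k.
  by apply: nb_sub => //; exists k.+1; right.
Qed.


(** * Covers by scattered families of squares *)

Lemma packing (q : int) (a b : nat -> int) : 0 < q ->
    (forall i, `|a i| <= 30 * q /\ `|b i| <= 30 * q) ->
  exists i j, [/\ (i < j)%N, (j < 50)%N, `|a i - a j| <= 10 * q & `|b i - b j| <= 10 * q].
Proof.
move=> q0 ab.
(* Steps of [10 * q] cut the interval from [-30 * q] to [30 * q] into 7 cells, the last holding only
   the right endpoint. Pairs fall into 49 boxes, one fewer than the 50 points. *)
pose cell (z : int) : 'I_7 := inord `|((z + 30 * q) %/ (10 * q))%Z|%N.
have cellP y z : `|y| <= 30 * q -> `|z| <= 30 * q -> cell y = cell z -> `|y - z| <= 10 * q.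
  have bd w : `|w| <= 30 * q -> 0 <= ((w + 30 * q) %/ (10 * q))%Z < 7.
    move=> wq; rewrite divz_ge0 ?ltz_divLR; lia.
  move=> yq zq /(congr1 (@nat_of_ord 7)); have := bd y yq; have := bd z zq.
  rewrite /cell => zb yb; rewrite !inordK; [|lia|lia] => yz.
  have {}yz : ((y + 30 * q) %/ (10 * q))%Z = ((z + 30 * q) %/ (10 * q))%Z by lia.
  have q1 : 0 < 10 * q by lia.
  have q1' : 10 * q != 0 by lia.
  have := (ltz_pmod (y + 30 * q) q1, ltz_pmod (z + 30 * q) q1).
  have := (modz_ge0 (y + 30 * q) q1', modz_ge0 (z + 30 * q) q1').
  have := (divz_eq (y + 30 * q) (10 * q), divz_eq (z + 30 * q) (10 * q)).
  rewrite yz; move: (modz _ _) (modz _ _) (divz _ _ * _) => m m' w [ey ez] [m0 m0'] [mq mq'].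
  clear -ey ez m0 m0' mq mq'; lia.
have : ~ injective (fun i : 'I_50 => (cell (a i), cell (b i))).
  by move=> /leq_card; rewrite card_prod !card_ord.
move=> ninj; apply: contrapT => nex; apply: ninj => i j [ca cb].
have da := cellP _ _ (ab i).1 (ab j).1 ca; have db := cellP _ _ (ab i).2 (ab j).2 cb.
apply: contrapT => ij; apply: nex.
have [lt_ij|lt_ji|eq_ij] := ltngtP i j.
- by exists i, j; split.
- by exists j, i; split; rewrite // distrC.
- by case: ij; exact: val_inj.
Qed.

(** Each family is maximal scattered in what the earlier squares leave uncovered. A point missed 50
    times would see a centre of every family within [30 * q]; two of these would be within [10 * q]
    of each other, so the later one would already have been covered. *)
Lemma scale_cover (R : realType) (q : int) : polish_space R X -> 0 < q ->
  exists M : nat -> set X, [/\ forall i, borel_set (M i),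
    forall i, scattered (30 * q) (M i) &
    forall x, exists2 i, (i < 50)%N & nb (10 * q) (M i) x].
Proof.
move=> polX q0.
have /choice[F FP] : forall S, exists M, borel_set S ->
    [/\ borel_set M, scattered (30 * q) M, M `<=` S & S `<=` nb (30 * q) M].
  move=> S; have [bS|nbS] := pselect (borel_set S); last by exists S.
  have r0 : 0 <= 30 * q by lia.
  by have [M ?] := maximal_scattered polX r0 bS; exists M.
pose C := fix C i := if i is i'.+1 then
  [set x | C i' x \/ nb (10 * q) (F [set y | ~ C i' y]) x] else set0.
pose M i := F [set x | ~ C i x].
have bC i : borel_set (C i).
  elim: i => [|i IH]; first exact: sigma_algebra0.
  apply: borel_or => //; apply: borel_nb.
  by have [] := FP _ (borel_not IH).
have CM i j : (i < j)%N -> nb (10 * q) (M i) `<=` C j.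
  elim: j => // j IH; rewrite ltnS leq_eqVlt => /orP[/eqP <- x|/IH h x /h]; [by right|by left].
exists M; split.
- by move=> i; have [] := FP _ (borel_not (bC i)).
- by move=> i; have [] := FP _ (borel_not (bC i)).
move=> x; apply: contrapT => ncov.
have nC i : (i <= 50)%N -> ~ C i x.
  elim: i => [_ []|i IH i50 [Cx|Mx]]; first by apply: IH => //; exact: ltnW.
  by apply: ncov; exists i.
have /choice[a aP] : forall i, exists a : int * int, (`|a.1| <= 30 * q /\ `|a.2| <= 30 * q) /\
    ((i < 50)%N -> M i (T a.1 a.2 x)).
  move=> i; have [i50|i50] := ltnP i 50; last first.
    by exists (0, 0); rewrite /= normr0; split; [lia|].
  have [_ _ _ /(_ x (nC _ (ltnW i50)))[c [d [cq dq Mx]]]] := FP _ (borel_not (bC i)).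
  by exists (c, d).
have [i [j [ij j50 da db]]] := packing q0 (fun i => (aP i).1).
have Mi := (aP i).2 (ltn_trans ij j50); have Mj := (aP j).2 j50.
have [_ _ /(_ _ Mj) + _] := FP _ (borel_not (bC j)); apply.
apply: (CM _ _ ij).
by exists ((a i).1 - (a j).1), ((a i).2 - (a j).2); split; rewrite // TD !subrK.
Qed.

(* Only boundedly many colours occur at each scale, so for every point some
   colour [i] covers it at infinitely many scales; moving along the orbit changes
   this only by a bounded distance, so one colour serves the whole orbit. *)
Lemma receding_cover (R : realType) (q : nat -> int) : polish_space R X ->
    (forall n, 0 < q n) -> (forall n, n%:Z <= q n) ->
  exists M : nat -> set X, [/\ forall n, borel_set (M n),
    forall n, scattered (30 * q n) (M n) &
    forall x, exists n, nb (11 * q n) (M n) x].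
Proof.
move=> polX q0 qn.
have /choice[M MP] := fun n => scale_cover polX (q0 n).
pose W i : set X := [set x | forall N : nat, exists n, (N <= n)%N /\ nb (10 * q n) (M n i) x].
pose sat S : set X := [set x | exists a b, S (T a b x)].
have satT S a b x : sat S (T a b x) <-> sat S x.
  split=> [[c [d]]|[c [d Sx]]]; first by rewrite TD; exists (c + a), (d + b).
  by exists (c - a), (d - b); rewrite TD !subrK.
have bsat S : borel_set S -> borel_set (sat S).
  by move=> bS; apply: borel_ex => a; apply: borel_ex => b; exact: borel_translate.
have bW i : borel_set (W i).
  apply: borel_all => N; apply: borel_ex => n; apply: borel_and; first exact: borel_const.
  by apply: borel_nb; have [] := MP n.
(* Orbits are sorted by the least colour that works somewhere on them, so families of different
   colours live on disjoint invariant sets. *)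
pose Y i : set X := [set x | sat (W i) x /\ forall j : nat, (j < i)%N -> ~ sat (W j) x].
have bY i : borel_set (Y i).
  apply: borel_and; first exact: bsat.
  apply: borel_all => j; apply: (@eq_borel _ [set x | ~ ((j < i)%N /\ sat (W j) x)]).
    by move=> x; split=> [h [ji] | h ji ?]; [exact: h|apply: h].
  apply: borel_not; apply: borel_and; [exact: borel_const|exact: bsat].
have YT i a b x : Y i x <-> Y i (T a b x).
  by rewrite /Y /= satT; split=> -[? h]; split=> // j; rewrite ?satT => /h; rewrite ?satT.
have Yuniq i j x : Y i x -> Y j x -> i = j.
  move=> [si hi] [sj hj]; have [ij|ji|//] := ltngtP i j; first by case: (hj i ij).
  by case: (hi j ji).
exists (fun n => [set x | exists i, Y i x /\ M n i x]); split.
- move=> n; apply: borel_ex => i; apply: borel_and => //; by have [] := MP n.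
- move=> n x a b [i [Yx Mx]] [j [Yy My]].
  have ij : i = j by apply: Yuniq Yx _; rewrite (YT j a b).
  by rewrite -ij in My; have [_ sc _] := MP n; exact: (sc i x a b Mx My).
move=> x.
have exW : exists i, `[< sat (W i) x >].
  apply: contrapT => nW.
  have /choice[N NP] : forall i, exists N : nat, forall n, (N <= n)%N -> ~ nb (10 * q n) (M n i) x.
    move=> i; apply: contrapT => nN; apply: nW; exists i; apply/asboolP.
    exists 0, 0; rewrite T0 => N; apply: contrapT => nn; apply: nN; exists N => n Nn nbx.
    by apply: nn; exists n.
  (* At a scale past the last use of each of the 50 colours, [x] would be uncovered. *)
  pose n := (\max_(i < 50) N i)%N.
  have [_ _ /(_ x)[i i50]] := MP n; apply: (NP i).
  exact: (leq_bigmax (Ordinal i50)).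
have [i /asboolP[a [b Wy]] imin] := ex_minnP exW.
have Yx : Y i x.
  split; first by exists a, b.
  move=> j; rewrite ltnNge => /negP ji sj; apply: ji; apply: imin; exact/asboolP.
(* At a scale with [|a| + |b| <= n <= q n], moving from [T a b x] back to [x] costs at most one
   [q n], whence the radius [11 * q n]. *)
have [n [nab [c [d [cq dq Mz]]]]] := Wy (`|a| + `|b|)%N.
have := qn n; exists n, (c + a), (d + b); split; try lia.
by exists i; rewrite -TD; split=> //; rewrite TD -YT.
Qed.


(** * Finite tiles of all scales with separated boundaries *)

Section Toast.
Variables (q : nat -> int) (M : nat -> set X).
Hypothesis q10 : forall n, 10 <= q n.
Hypothesis qS : forall n, 31 * q n <= q n.+1.
Hypothesis Msc : forall n, scattered (30 * q n) (M n).

Definition absorb j S : set X :=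
  [set x | S x \/ nb (12 * q j) [set y | M j y /\ nb (18 * q j) S y] x].

(* Absorption must run from the largest scale down: what is absorbed at scale [j]
   is too small to approach a ball of a larger scale that was not absorbed. *)
Fixpoint absorb_below k S : set X :=
  if k is k'.+1 then absorb_below k' (absorb k' S) else S.

Lemma absorb_below_sub k S : S `<=` absorb_below k S.
Proof. by elim: k S => [|k IH] S x Sx //=; apply: IH; left. Qed.

(** Scale [k] adds at most [(12 + 18) * q k], and [31 * q k <= q k.+1] leaves one more [q k] for all
    the smaller scales together. *)
Lemma absorb_below_near k S : absorb_below k S `<=` nb (q k - 10) S.
Proof.
elim: k S => [|k IH] S x /=.
  by apply: nb_sub; have := q10 0; lia.
move/IH => [a [b [ak bk [Sx|]]]].
  by exists a, b; split=> //; have := qS k; have := q10 k; lia.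
move=> [c [d [ck dk [_ [e [f [ek fk]]]]]]]; rewrite !TD => Sx.
by exists (e + c + a), (f + d + b); split=> //; have := qS k; lia.
Qed.

(** If [c] is not absorbed at its turn, the set is more than [18 * q j] away. The other centres of
    that scale are beyond [30 * q j], so their balls of radius [12 * q j] keep the same distance,
    and smaller scales consume less than one further [q j]. *)
Lemma absorb_below_dichotomy j k S c : (j < k)%N -> M j c ->
  (forall a b, `|a| <= 12 * q j -> `|b| <= 12 * q j -> absorb_below k S (T a b c))
  \/ ~ nb (17 * q j) (absorb_below k S) c.
Proof.
elim: k S => // k IH S; rewrite ltnS leq_eqVlt => /orP[/eqP -> Mc|/IH h Mc]; last exact: h.
have qk := q10 k.
have [Sc|nSc] := pselect (nb (18 * q k) S c).
  left=> a b ak bk /=; apply: absorb_below_sub; right.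
  by exists (- a), (- b); rewrite TD !addNr T0 !normrN.
right=> /= -[a [b [ak bk /absorb_below_near[d [e [dk ek]]]]]]; rewrite TD => -[Sx|].
  by apply: nSc; exists (d + a), (e + b); split=> //; lia.
move=> [f [g [fk gk []]]]; rewrite TD => My Sy.
have [f0 g0] : f + (d + a) = 0 /\ g + (e + b) = 0 by apply: Msc Mc My _ _; lia.
by apply: nSc; rewrite f0 g0 T0 in Sy.
Qed.

(** The position of [x] relative to a nearby centre. Two such centres would be within [24 * q n], so
    scatteredness at [30 * q n] makes it unique. *)
Definition coords n x a b : Prop :=
  M n (T (- a) (- b) x) /\ (`|a| <= 12 * q n /\ `|b| <= 12 * q n).

Definition core n : set X := absorb_below n (nb (11 * q n) (M n)).

(* Completing [core n] to a union of 2 x 2 blocks aligned with the centre. *)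
Definition tile n : set X := [set x | exists a b a' b',
  [/\ coords n x a b, (a' %/ 2 = a %/ 2)%Z, (b' %/ 2 = b %/ 2)%Z &
      core n (T (a' - a) (b' - b) x)]].

Lemma coords_uniq n x a b a' b' :
  coords n x a b -> coords n x a' b' -> a = a' /\ b = b'.
Proof.
move=> [Ma [an bn]] [Ma' [an' bn']].
have [] : a - a' = 0 /\ b - b' = 0; last lia.
apply: (Msc (x := T (- a) (- b) x) (n := n)); rewrite ?TD //; try lia.
by rewrite (_ : a - a' - a = - a') 1?(_ : b - b' - b = - b') //; lia.
Qed.

Lemma core_coords n x : core n x ->
  exists a b, [/\ M n (T (- a) (- b) x), `|a| <= 12 * q n - 10 & `|b| <= 12 * q n - 10].
Proof.
move=> /absorb_below_near[a [b [an bn [c [d [cn dn]]]]]]; rewrite TD => Mx.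
by exists (- (c + a)), (- (d + b)); rewrite !opprK; split=> //; lia.
Qed.

Lemma core_sub_tile n : core n `<=` tile n.
Proof.
move=> x Cx; have [a [b [Mx an bn]]] := core_coords Cx.
by exists a, b, a, b; rewrite !subrr T0; split=> //; split=> //; lia.
Qed.

(** Completing a block moves each coordinate by at most 1, so the core's margin 10 becomes 9; this
    leaves room for valid coordinates on a 2-neighbourhood of the tile. *)
Lemma tile_inv n x : tile n x -> exists a b e f,
  [/\ M n (T (- a) (- b) x), `|a| <= 12 * q n - 9 /\ `|b| <= 12 * q n - 9,
      `|e| <= 1 /\ `|f| <= 1 & core n (T e f x)].
Proof.
move=> [a [b [a' [b' [[Mx [an bn]] aa bb Cx]]]]].
have [c [d [My cn dn]]] := core_coords Cx; rewrite TD in My; have qn := q10 n.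
have [ca db] : a' - c = 0 /\ b' - d = 0.
  apply: (Msc Mx); [|lia|lia].
  by rewrite TD (_ : a' - c - a = - c + (a' - a)) 1?(_ : b' - d - b = - d + (b' - b)) //; lia.
by exists a, b, (a' - a), (b' - b); split=> //; lia.
Qed.

Lemma tile_coords n x : tile n x -> exists a b, forall c d,
  `|c| <= 2 -> `|d| <= 2 -> coords n (T c d x) (a + c) (b + d).
Proof.
move=> /tile_inv[a [b [_ [_ [Mx [an bn] _ _]]]]]; exists a, b => c d c2 d2.
split; last lia.
by rewrite TD (_ : - (a + c) + c = - a) 1?(_ : - (b + d) + d = - b) //; lia.
Qed.

Lemma tile_aligned n x a b c d :
    tile n x -> coords n x a b -> coords n (T c d x) (a + c) (b + d) ->
    ((a + c) %/ 2 = a %/ 2)%Z -> ((b + d) %/ 2 = b %/ 2)%Z ->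
  tile n (T c d x).
Proof.
move=> [a0 [b0 [a' [b' [P0 aa bb Cx]]]]] Px Py ca db.
have [a0a b0b] := coords_uniq P0 Px; subst a0 b0.
exists (a + c), (b + d), a', b'; split=> //; [by rewrite ca|by rewrite db|].
by rewrite TD (_ : a' - (a + c) + c = a' - a) 1?(_ : b' - (b + d) + d = b' - b) //; lia.
Qed.

(** The larger core comes within [12 * q j - 6] of the centre of the smaller tile. The dichotomy
    then puts the whole ball of radius [12 * q j], hence the 2-neighbourhood of [x], inside that
    core. *)
Lemma tile_nested j n x c d : (j < n)%N -> tile j x ->
    `|c| <= 2 -> `|d| <= 2 -> tile n (T c d x) ->
  forall c' d', `|c'| <= 2 -> `|d'| <= 2 -> tile n (T c' d' x).
Proof.
move=> jn /tile_inv[a [b [_ [_ [Mx [aj bj] _ _]]]]] c2 d2.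
move=> /tile_inv[_ [_ [e [f [_ _ [e1 f1] Cy]]]]] c' d' c2' d2'.
have qj := q10 j; rewrite TD in Cy.
have [ball|[]] := absorb_below_dichotomy (nb (11 * q n) (M n)) jn Mx.
  apply: core_sub_tile; have := ball (a + c') (b + d'); rewrite TD.
  by rewrite (_ : a + c' - a = c') 1?(_ : b + d' - b = d'); [apply| |]; lia.
exists (e + c + a), (f + d + b); rewrite TD !addrK; split=> //; lia.
Qed.

Lemma borel_core n : (forall n, borel_set (M n)) -> borel_set (core n).
Proof.
move=> bM; have : borel_set (nb (11 * q n) (M n)) by exact: borel_nb.
rewrite /core; move: (nb _ _); elim: n => //= n IH S bS; apply: IH.
apply: borel_or => //; apply: borel_nb; apply: borel_and => //; exact: borel_nb.
Qed.

Lemma borel_coords n a b :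
  (forall n, borel_set (M n)) -> borel_set [set x | coords n x a b].
Proof.
by move=> bM; apply: borel_and; [exact: borel_translate|exact: borel_const].
Qed.

Lemma borel_tile n : (forall n, borel_set (M n)) -> borel_set (tile n).
Proof.
move=> bM; apply: borel_ex => a; apply: borel_ex => b.
apply: borel_ex => a'; apply: borel_ex => b'.
apply: (@eq_borel _ [set x | coords n x a b /\ (((a' %/ 2 = a %/ 2)%Z /\ (b' %/ 2 = b %/ 2)%Z) /\
    core n (T (a' - a) (b' - b) x))]).
  by move=> x; split=> [[? ? ? ?]|[? [[? ?] ?]]].
apply: borel_and; first exact: borel_coords.
by apply: borel_and; [exact: borel_const|apply: borel_translate; exact: borel_core].
Qed.

End Toast.

(** * The matching determined by nested tiles *)

Section NestedTiles.
Variables (A : nat -> set X) (P : nat -> X -> int -> int -> Prop).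
Hypothesis Puniq : forall n x a b a' b', P n x a b -> P n x a' b' -> a = a' /\ b = b'.
Hypothesis AP : forall n x, A n x -> exists a b, forall c d,
  `|c| <= 2 -> `|d| <= 2 -> P n (T c d x) (a + c) (b + d).
Hypothesis Aaligned : forall n x a b c d,
  A n x -> P n x a b -> P n (T c d x) (a + c) (b + d) ->
  ((a + c) %/ 2 = a %/ 2)%Z -> ((b + d) %/ 2 = b %/ 2)%Z -> A n (T c d x).
Hypothesis Anested : forall j n x c d, (j < n)%N -> A j x ->
  `|c| <= 2 -> `|d| <= 2 -> A n (T c d x) ->
  forall c' d', `|c'| <= 2 -> `|d'| <= 2 -> A n (T c' d' x).
Hypothesis Acover : forall x, exists n, A n x.
Hypothesis bA : forall n, borel_set (A n).
Hypothesis bP : forall n a b, borel_set [set x | P n x a b].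

Lemma translate_to a b c d x : T c d x = T (c - a) (d - b) (T a b x).
Proof. by rewrite TD !subrK. Qed.

Lemma coords_shift n u v c d c' d' a b a' b' x :
    A n (T u v x) -> P n (T c d x) a b ->
    `|c - u| <= 2 -> `|d - v| <= 2 -> `|c' - u| <= 2 -> `|d' - v| <= 2 ->
    a' = a + (c' - c) -> b' = b + (d' - d) ->
  P n (T c' d' x) a' b'.
Proof.
move=> /AP[a0 [b0 P0]] Pab cu dv cu' dv'.
have := P0 _ _ cu dv; rewrite -translate_to => /(Puniq Pab)[-> ->] ea eb.
have := P0 _ _ cu' dv'; rewrite -translate_to.
by rewrite (_ : a0 + (c' - u) = a') 1?(_ : b0 + (d' - v) = b') //; lia.
Qed.

Lemma nested_at j n a b c d c' d' x :
    (j < n)%N -> A j (T a b x) -> A n (T c d x) ->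
    `|c - a| <= 2 -> `|d - b| <= 2 -> `|c' - a| <= 2 -> `|d' - b| <= 2 ->
  A n (T c' d' x).
Proof.
move=> jn Aj An ca db ca' db'; rewrite (translate_to a b).
by apply: (Anested jn Aj ca db _ ca' db'); rewrite -translate_to.
Qed.

Lemma aligned_at n c d c' d' a b x :
    A n (T c d x) -> P n (T c d x) a b ->
    ((a + (c' - c)) %/ 2 = a %/ 2)%Z -> ((b + (d' - d)) %/ 2 = b %/ 2)%Z ->
  A n (T c' d' x).
Proof.
move=> An Pn ac bd; rewrite (translate_to c d).
apply: (Aaligned An Pn) => //; rewrite -translate_to.
by apply: (coords_shift An Pn); lia.
Qed.

Definition least n x := A n x /\ forall j, (j < n)%N -> ~ A j x.

Lemma least_exists x : exists n, least n x.
Proof.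
have [n0 An0] := Acover x.
have exA : exists n, `[< A n x >] by exists n0; exact/asboolP.
have [n /asboolP An nmin] := ex_minnP exA; exists n; split=> // j.
by rewrite ltnNge => /negP jn Aj; apply: jn; apply: nmin; exact/asboolP.
Qed.

Lemma least_uniq n n' x : least n x -> least n' x -> n = n'.
Proof.
move=> [An nmin] [An' nmin']; have [nn'|n'n|//] := ltngtP n n'.
  by case: (nmin' n nn').
by case: (nmin n' n'n).
Qed.

(** The step from [a] to the other element of its pair [2k, 2k+1]. *)
Definition mate (a : int) : int := if (a %% 2 == 0)%Z then 1 else -1.

Lemma mateP (a : int) : [/\ `|mate a| = 1, ((a + mate a) %/ 2 = a %/ 2)%Z,
  mate (a + mate a) = - mate a &
  forall b, ((a - b) %% 2)%Z = 0 <-> mate b = mate a].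
Proof.
rewrite /mate; case: eqP => a0; (split; [lia|lia| |move=> b]); case: eqP; lia.
Qed.

(* [x] lies beside a lower-level tile whose blocks are out of phase
   horizontally with the blocks of the tile of [x]. *)
Definition seam n a x j s a' b' : Prop :=
  [/\ (j < n)%N, `|s| = 1, A j (T s 0 x), P j x a' b' & ((a - a') %% 2)%Z <> 0].

(** The partner of [x] is [T e f x]. Beside a seam the vertical pairing uses the coordinate [b'] of
    the lower tile, so that both ends border the same block of that tile. *)
Definition partner x e f : Prop :=
  (exists n a b, (least n x /\ P n x a b) /\
    exists j s a' b', seam n a x j s a' b' /\ (e = 0 /\ f = mate b')) \/
  (exists n a b, (least n x /\ P n x a b) /\
    ((forall j s a' b', ~ seam n a x j s a' b') /\ (e = mate a /\ f = 0))).

Lemma tile_coord n x : A n x -> exists a b, P n x a b.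
Proof.
by move=> /AP[a [b /(_ 0 0)]]; rewrite T0 !addr0 => Pn; exists a, b; apply: Pn; rewrite normr0.
Qed.

(** Two tiles of different levels bordering [x] would be nested with room to spare, so the larger
    would contain [x], against the minimality of [n]. *)
Lemma seam_uniq n a x j s a' b' j1 s1 a1 b1 : least n x ->
  seam n a x j s a' b' -> seam n a x j1 s1 a1 b1 -> b' = b1.
Proof.
move=> [_ nmin] [jn s0 Aj Pj _] [j1n s10 Aj1 Pj1 _].
have [jj1|j1j|jj1] := ltngtP j j1.
- case: (nmin j1 j1n); rewrite -(T0 x); apply: (nested_at jj1 Aj Aj1); lia.
- case: (nmin j jn); rewrite -(T0 x); apply: (nested_at j1j Aj1 Aj); lia.
- by subst j1; have [] := Puniq Pj Pj1.
Qed.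

Lemma partner_exists x : exists e f, partner x e f.
Proof.
have [n nx] := least_exists x; have [a [b Pn]] := tile_coord nx.1.
have [[j [s [a' [b' sm]]]]|nsm] := pselect (exists j s a' b', seam n a x j s a' b').
  by exists 0, (mate b'); left; exists n, a, b; split=> //; exists j, s, a', b'.
exists (mate a), 0; right; exists n, a, b; split=> //; split=> // j s a' b' sm.
by apply: nsm; exists j, s, a', b'.
Qed.

Lemma partner_uniq x e f e' f' : partner x e f -> partner x e' f' -> e = e' /\ f = f'.
Proof.
case=> [[n [a [b [[nx Pn] [j [s [a' [b' [sm [-> ->]]]]]]]]]]|[n [a [b [[nx Pn] [nsm [-> ->]]]]]]].
  case=> [[n1 [a1 [b1 [[nx1 Pn1] [j1 [s1 [a1' [b1' [sm1 [-> ->]]]]]]]]]]|[n1 [a1 [b1 [[nx1 Pn1] [nsm1 _]]]]]];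
    have nn := least_uniq nx1 nx; subst n1; have [aa bb] := Puniq Pn1 Pn; subst a1 b1.
  - by rewrite (seam_uniq nx sm sm1).
  - by case: (nsm1 _ _ _ _ sm).
case=> [[n1 [a1 [b1 [[nx1 Pn1] [j1 [s1 [a1' [b1' [sm1 [-> ->]]]]]]]]]]|[n1 [a1 [b1 [[nx1 Pn1] [nsm1 [-> ->]]]]]]];
  have nn := least_uniq nx1 nx; subst n1; have [aa bb] := Puniq Pn1 Pn; subst a1 b1.
- by case: (nsm _ _ _ _ sm1).
- by [].
Qed.

Lemma partner_step x e f : partner x e f ->
  (`|e| = 1 /\ f = 0) \/ (e = 0 /\ `|f| = 1).
Proof.
case=> [[n [a [b [_ [j [s [a' [b' [_ [-> ->]]]]]]]]]]|[n [a [b [_ [_ [-> ->]]]]]]].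
  by right; have [] := mateP b'.
by left; have [] := mateP a.
Qed.

(** Alignment puts the neighbour [T s f x] of the partner in the same lower tile, and the partner
    itself outside it. Nesting excludes every other level below [n], so the partner sees the same
    seam. *)
Lemma partner_vertical x n a b j s a' b' : least n x -> P n x a b ->
    seam n a x j s a' b' ->
  partner (T 0 (mate b') x) 0 (- mate b').
Proof.
move=> [An nmin] Pn [jn s1 Aj Pj odd_aa].
have [f1 fb mf _] := mateP b'; set f := mate b' in f1 fb mf *; set y := T 0 f x.
rewrite -(T0 x) in An Pn Pj.
have Any : A n y by apply: (nested_at jn Aj An); lia.
have Pjs : P j (T s 0 x) (a' + s) b' by apply: (coords_shift Aj Pj); lia.
have Ajy : A j (T s f x) by apply: (aligned_at Aj Pjs); lia.
have Pjy : P j y a' (b' + f) by apply: (coords_shift Aj Pj); lia.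
have Pny : P n y a (b + f) by apply: (coords_shift An Pn); lia.
have nAjy : ~ A j y.
  move=> Ay; apply: (nmin j jn); rewrite -(T0 x); apply: (aligned_at Ay Pjy); lia.
left; exists n, a, (b + f); split; [split=> //; split=> // i i_n Aiy|].
  have [ij|ji|eq_ij] := ltngtP i j.
  - by apply: nAjy; apply: (nested_at ij Aiy Ajy); lia.
  - by apply: (nmin i i_n); rewrite -(T0 x); apply: (nested_at ji Ajy Aiy); lia.
  - by rewrite eq_ij in Aiy.
exists j, s, a', (b' + f); split; last by rewrite mf.
by split=> //; rewrite /y TD addr0 add0r.
Qed.

(** A lower tile containing the partner would border [x]; without a seam it is in phase, so its
    blocks would contain [x] too. *)
Lemma partner_horizontal x n a b : least n x -> P n x a b ->
    (forall j s a' b', ~ seam n a x j s a' b') ->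
  partner (T (mate a) 0 x) (- mate a) 0.
Proof.
move=> [An nmin] Pn nsm.
have [e1 ea me mate_eq] := mateP a; set e := mate a in e1 ea me mate_eq *; set y := T e 0 x.
rewrite -(T0 x) in An Pn.
have Any : A n y by apply: (aligned_at An Pn); lia.
have Pny : P n y (a + e) b by apply: (coords_shift An Pn); lia.
have nAy i : (i < n)%N -> ~ A i y.
  move=> i_n Aiy; have [a1 [b1 Piy]] := tile_coord Aiy.
  have Pix : P i (T 0 0 x) (a1 - e) b1 by apply: (coords_shift Aiy Piy); lia.
  have aa : ((a - (a1 - e)) %% 2)%Z = 0.
    apply: contrapT => odd_aa; apply: (nsm i e (a1 - e) (b1)).
    by split=> //; rewrite -(T0 x).
  have /mate_eq ma := aa; have [_ + _ _] := mateP (a1 - e); rewrite ma => a1e.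
  apply: (nmin i i_n); rewrite -(T0 x); apply: (aligned_at Aiy Piy); lia.
right; exists n, (a + e), b; split; [split=> //; split=> //|split; last by rewrite me].
move=> j s a' b' [jn s1]; rewrite /y TD addr0 => Aj Pj odd_aa.
(* A seam on the far side of [y] would have phase opposite to the pair of [x] and [y], hence a block
   joining [y] to the lower tile; on the near side the lower tile would contain [x]. *)
have [es|se] : e = s \/ s = - e by lia.
  subst s; apply: (nAy j jn).
  have Pjs : P j (T (e + e) 0 x) (a' + e) b'.
    by apply: (coords_shift Aj Pj); lia.
  have aa : ((a - a') %% 2)%Z = 0 by lia.
  have /mate_eq ma := aa; have [_ + _ _] := mateP a'; rewrite ma => a'e.
  apply: (aligned_at Aj Pjs); lia.
by rewrite se addNr T0 in Aj; case: (nmin j jn).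
Qed.

Lemma partner_sym x e f : partner x e f -> partner (T e f x) (- e) (- f).
Proof.
case=> [[n [a [b [[nx Pn] [j [s [a' [b' [sm [-> ->]]]]]]]]]]|[n [a [b [[nx Pn] [nsm [-> ->]]]]]]];
  rewrite oppr0.
  exact: (partner_vertical nx Pn sm).
exact: (partner_horizontal nx Pn nsm).
Qed.

Lemma borel_least n : borel_set [set x | least n x].
Proof.
apply: borel_and => //; apply: borel_all => j.
apply: (@eq_borel _ [set x | ~ ((j < n)%N /\ A j x)]).
  by move=> x; split=> [h [ji] | h ji ?]; [exact: h|apply: h].
by apply: borel_not; apply: borel_and => //; exact: borel_const.
Qed.

Lemma borel_seam n a j s a' b' : borel_set [set x | seam n a x j s a' b'].
Proof.
apply: (@eq_borel _ [set x | (((j < n)%N /\ `|s| = 1) /\ A j (T s 0 x)) /\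
  (P j x a' b' /\ ((a - a') %% 2)%Z <> 0)]).
  by move=> x; split=> [[]|[[[? ?] ?] [? ?]]].
apply: borel_and; last by apply: borel_and; [exact: bP|exact: borel_const].
by apply: borel_and; [exact: borel_const|exact: borel_translate].
Qed.

Lemma borel_partner e f : borel_set [set x | partner x e f].
Proof.
apply: borel_or; apply: borel_ex => n; apply: borel_ex => a; apply: borel_ex => b;
  apply: borel_and.
- by apply: borel_and; [exact: borel_least|exact: bP].
- apply: borel_ex => j; apply: borel_ex => s; apply: borel_ex => a'; apply: borel_ex => b'.
  by apply: borel_and; [exact: borel_seam|exact: borel_const].
- by apply: borel_and; [exact: borel_least|exact: bP].
apply: borel_and; last exact: borel_const.
apply: borel_all => j; apply: borel_all => s; apply: borel_all => a'; apply: borel_all => b'.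
by apply: borel_not; exact: borel_seam.
Qed.

End NestedTiles.

(** * Choice of scales and passage to the given action *)

Lemma partner_assignment (R : realType) : polish_space R X ->
  exists p : X -> int -> int -> Prop,
  [/\ forall e f, borel_set [set x | p x e f],
      forall x, exists e f, p x e f,
      forall x e f e' f', p x e f -> p x e' f' -> e = e' /\ f = f',
      forall x e f, p x e f -> (`|e| = 1 /\ f = 0) \/ (e = 0 /\ `|f| = 1) &
      forall x e f, p x e f -> p (T e f x) (- e) (- f)].
Proof.
move=> polX.
(* The factor 10 gives the margins inside tiles, and the ratio 100 exceeds the required 31. *)
pose q n : int := 10 * 100 ^+ n.
have q10 n : 10 <= q n by rewrite /q; elim: n => // n; rewrite exprS; lia.
have qS n : 31 * q n <= q n.+1 by have := q10 n; rewrite /q exprS; lia.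
have qn n : n%:Z <= q n by elim: n => // n; have := qS n; have := q10 n; lia.
have q0 n : 0 < q n by have := q10 n; lia.
have [M [bM Msc cov]] := receding_cover polX q0 qn.
have Acov x : exists n, tile q M n x.
  have [n Mn] := cov x; exists n; apply: core_sub_tile => //.
  exact: absorb_below_sub.
exists (partner (tile q M) (coords q M)); split.
- by move=> e f; apply: borel_partner => n; [exact: borel_tile|move=> a b; exact: borel_coords].
- apply: partner_exists => //; exact: tile_coords.
- apply: partner_uniq; [exact: coords_uniq|exact: tile_nested].
- exact: partner_step.
- apply: partner_sym; [exact: coords_uniq|exact: tile_coords|exact: tile_aligned|exact: tile_nested].
Qed.

End PlaneAction.

Theorem theorem1p2 (R : realType) (n : nat) (hn : (2 <= n)%N)
    (X : topologicalType) (hX : polish_space R X)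
    (act : 'rV[int]_n -> X -> X)
    (hact : borel_action act) (hfree : free_action act) :
  exists m : X -> X,
    borel_map m /\ perfect_matching (schreier_graph act) m.
Proof.
have [[act0 actD] act_borel] := hact.
pose i0 : 'I_n := Ordinal (ltnW hn); pose i1 : 'I_n := Ordinal hn.
pose vec (a b : int) : 'rV[int]_n := a *: delta_mx 0 i0 + b *: delta_mx 0 i1.
pose T a b := act (vec a b).
have T0 x : T 0 0 x = x by rewrite /T /vec !scale0r addr0 act0.
have TD a b c d x : T a b (T c d x) = T (a + c) (b + d) x.
  by rewrite /T -actD; congr act; rewrite /vec !scalerDl addrACA.
have Tfree a b x : T a b x = x -> a = 0 /\ b = 0.
  move=> /hfree /rowP v0; have := v0 i0; have := v0 i1.
  by rewrite !mxE /= !mulr1 !mulr0 addr0 add0r.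
have Tborel a b S : borel_set S -> borel_set (T a b @^-1` S).
  by move=> /act_borel/(borel_section (vec a b : discrete_topology 'rV[int]_n)).
have [p [bp pex puniq pstep psym]] := partner_assignment T0 TD Tfree Tborel hX.
(* Choice does no harm to measurability: [p] determines the step, so preimages below are countable
   unions over [e] and [f]. *)
have /choice[g gP] : forall x, exists g : int * int, p x g.1 g.2.
  by move=> x; have [e [f pxef]] := pex x; exists (e, f).
exists (fun x => T (g x).1 (g x).2 x); split.
  move=> B bB; apply: (@eq_borel _ [set x | exists e f : int, p x e f /\ B (T e f x)]).
    move=> x; split=> [Bx|[e [f [pxef Bx]]]].
      by exists (g x).1, (g x).2.
    by rewrite /preimage /=; have [-> ->] := puniq _ _ _ _ _ (gP x) pxef.
  apply: borel_ex => e; apply: borel_ex => f; apply: borel_and; [exact: bp|exact: Tborel].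
move=> x; split.
  exists (vec (g x).1 (g x).2) => //.
  have [[e1 ->]|[-> f1]] := pstep _ _ _ (gP x); rewrite /vec scale0r ?addr0 ?add0r.
    exists i0; have [->|->] : (g x).1 = 1 \/ (g x).1 = -1 by lia.
      by left; rewrite scale1r.
    by right; rewrite scaleN1r.
  exists i1; have [->|->] : (g x).2 = 1 \/ (g x).2 = -1 by lia.
    by left; rewrite scale1r.
  by right; rewrite scaleN1r.
have [-> ->] := puniq _ _ _ _ _ (gP _) (psym _ _ _ (gP x)).
by rewrite TD !addNr T0.
Qed.
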